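(* Let $\mathcal{H}$ be an infinite-dimensional complex Hilbert space (not necessarily separable) and let $T$ be a bounded linear operator on $\mathcal{H}$. If $T$ is power bounded, that is, $\sup_n\|T^n\|<\infty$, then $\sigma_R(T)\subseteq\mathbb{D}$, where $\sigma_R(T)$ is the residual spectrum of $T$ and $\mathbb{D}$ is the open unit disk in $\mathbb{C}$.
   Context: For a bounded linear operator $T$ on $\mathcal{H}$ with adjoint $T^*$, the point spectrum is $\sigma_P(T)=\{\lambda\in\mathbb{C}:\ \ker(\lambda I-T)\neq\{0\}\}$, the set of eigenvalues of $T$. For $\Lambda\subseteq\mathbb{C}$ write $\Lambda^*=\{\overline{\lambda}:\lambda\in\Lambda\}$. The residual spectrum of $T$ is $\sigma_R(T)=\sigma_P(T^* )^*\setminus\sigma_P(T)$. $\mathbb{D}=\{\lambda\in\mathbb{C}:|\lambda|<1\}$. *)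

(* Defs.v *)
From mathcomp Require Import all_boot all_order all_algebra.
From mathcomp Require Import complex.
From mathcomp Require Import all_classical all_reals all_analysis.

Set Implicit Arguments.
Unset Strict Implicit.
Unset Printing Implicit Defensive.

Import Order.TTheory GRing.Theory Num.Theory.
Import numFieldNormedType.Exports.

Local Open Scope classical_set_scope.
Local Open Scope ring_scope.
Local Open Scope complex_scope.

(* A complex Hilbert space is a complete normed space H over R[i] whose norm is
   the one induced by a positive definite Hermitian form.  The convention of
   {dot H for Num.conj} is linearity on the left, conjugate-linearity on the
   right. *)
Definition inner_product_of_norm (R : realType) (H : completeNormedModType R[i])
    (dot : {dot H for Num.conj}) : Prop :=
  forall x : H, dot x x = `|x| ^+ 2.

Definition finite_dimensional (K : fieldType) (V : lmodType K) : Prop :=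
  exists (n : nat) (b : 'I_n -> V),
    forall x : V, exists c : 'I_n -> K, x = \sum_(i < n) c i *: b i.

Section Operators.
Variables (R : realType) (H : completeNormedModType R[i]).
Implicit Types S : H -> H.

(* Norms in H are R[i]-valued (with zero imaginary part), hence the Re. *)
Definition operator_norm S : \bar R :=
  ereal_sup [set (complex.Re `|S x|)%:E | x in [set x : H | `|x| <= 1]].

Definition power_bounded S : Prop :=
  (ereal_sup (range (fun n : nat => operator_norm (iter n S))) < +oo)%E.

(* For a bounded linear S, the Riesz representation theorem says that exactly
   one z satisfies the condition below; the default value 0 is then unused. *)
Definition adjoint (dot : {dot H for Num.conj}) S : H -> H :=
  fun y => xget 0 [set z : H | forall x : H, dot (S x) y = dot x z].

Definition point_spectrum S : set R[i] :=
  [set l : R[i] | [set x : H | l *: x - S x = 0] <> [set 0]].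

Definition conj_set (L : set R[i]) : set R[i] := [set Num.conj l | l in L].

Definition residual_spectrum (dot : {dot H for Num.conj}) S : set R[i] :=
  conj_set (point_spectrum (adjoint dot S)) `\` point_spectrum S.

End Operators.

Definition open_unit_disk (R : realType) : set R[i] := [set l : R[i] | `|l| < 1].
Arguments open_unit_disk : clear implicits.

(* Main.v *)
(* Suppose that T^* y = conj(l) y with y <> 0 and |l| >= 1, so that
   <T x, y> = l <x, y> for all x.  The averages over k <= n of (T/l)^k y are
   bounded, satisfy |T x - l x| = O(1/n), and have inner product <y, y> with y.
   The sets C_n of all x with |T x - l x| <= c/n and <x, y> = <y, y> are convex
   and decreasing, so their elements of nearly minimal norm converge to some z
   (a substitute for weak compactness).  Then T z = l z, and |z| >= |y| > 0, so l
   is an eigenvalue of T and does not lie in the residual spectrum. *)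
Require Import Defs.
From mathcomp Require Import all_boot all_order all_algebra.
From mathcomp Require Import complex.
From mathcomp Require Import all_classical all_reals all_analysis.
From mathcomp Require Import ring lra.

Import Order.TTheory GRing.Theory Num.Theory.
Import numFieldNormedType.Exports.
Local Open Scope classical_set_scope.
Local Open Scope ring_scope.
Local Open Scope complex_scope.

(** The order of [R[i]] is only partial; a norm with values in [R] gives access to [inf], [sup] and
    [lra]. *)
Definition rnorm {R : realType} {V : normedModType R[i]} (x : V) : R :=
  complex.Re `|x|.

(** * Real-valued norms *)

Section RealNorm.
Context {R : realType} {V : normedModType R[i]}.
Implicit Types (x y : V) (a : R[i]).

Lemma rnormE x : `|x| = (rnorm x)%:C.
Proof.
have := normr_ge0 x; rewrite /rnorm.
by case: `|x| => u v; rewrite lecE /= => /andP[/eqP-> _].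
Qed.

Lemma rnorm_ge0 x : 0 <= rnorm x.
Proof. by rewrite -lecR -rnormE normr_ge0. Qed.

Lemma rnormD x y : rnorm (x + y) <= rnorm x + rnorm y.
Proof. by rewrite -lecR rmorphD/= -!rnormE ler_normD. Qed.

Lemma rnormN x : rnorm (- x) = rnorm x.
Proof. by rewrite /rnorm normrN. Qed.

Lemma rnormB x y : rnorm (x - y) <= rnorm x + rnorm y.
Proof. by rewrite (le_trans (rnormD _ _))// rnormN. Qed.

Lemma rnormZ a x : rnorm (a *: x) = complex.Re `|a| * rnorm x.
Proof.
by rewrite {1}/rnorm normrZ rnormE; case: `|a| => u v /=; rewrite mulr0 subr0.
Qed.

Lemma rnorm0 : rnorm (0 : V) = 0.
Proof. by rewrite /rnorm normr0. Qed.

Lemma rnorm_eq0 x : (rnorm x == 0) = (x == 0).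
Proof. by rewrite -(normr_eq0 x) rnormE eq_complex /= eqxx andbT. Qed.

Lemma gt0_real_complex (e : R[i]) : 0 < e -> exists2 r : R, 0 < r & e = r%:C.
Proof. by case: e => u v; rewrite ltcE /= => /andP[/eqP-> u0]; exists u. Qed.

Lemma rnorm_ball x (e : R) y : ball x e%:C y = (rnorm (x - y) < e).
Proof. by rewrite -ball_normE /ball_ /= rnormE ltcR. Qed.

Lemma closure_rnorm (A : set V) z :
  closure A z -> forall e : R, 0 < e -> exists2 x, A x & rnorm (z - x) < e.
Proof.
move=> Az e e0; have e0' : 0 < e%:C by rewrite ltcR.
have [x [Ax zx]] := Az _ (nbhsx_ballx z _ e0').
by exists x => //; rewrite -rnorm_ball.
Qed.

End RealNorm.

(** * Geometry of the Hilbert space *)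

Section HilbertSpace.
Context {R : realType} {H : completeNormedModType R[i]}.
Context {dot : {dot H for Num.conj}}.
Hypothesis hdot : inner_product_of_norm dot.

Lemma dot_rnorm (x : H) : dot x x = (rnorm x ^+ 2)%:C.
Proof. by rewrite hdot rnormE rmorphXn. Qed.

Lemma parallelogram (x y : H) :
  rnorm (x + y) ^+ 2 + rnorm (x - y) ^+ 2 = 2 * (rnorm x ^+ 2 + rnorm y ^+ 2).
Proof.
apply: (@complexI R); rewrite rmorphM !rmorphD /= -!dot_rnorm dnormD dnormB.
by rewrite rmorph1; ring.
Qed.

(* Near-minimal norm elements of the [C n] form a Cauchy sequence by the
   parallelogram law, since the infima of the norm over [C n] increase to a
   finite limit. *)
Lemma nested_midconvex_closure (C : nat -> set H) (M : R) :
    (forall m n, (m <= n)%N -> C n `<=` C m) ->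
    (forall n x y, C n x -> C n y -> C n (2^-1 *: (x + y))) ->
    (forall n, exists2 x, C n x & rnorm x <= M) ->
  exists z, forall n, closure (C n) z.
Proof.
move=> decC midC bndC.
(* Squared norms make the parallelogram law linear in the quantities to be compared. *)
pose E n := [set rnorm x ^+ 2 | x in C n].
have lbE n : lbound (E n) 0 by move=> _ [x _ <-]; exact: sqr_ge0.
have infE n x : C n x -> inf (E n) <= rnorm x ^+ 2.
  by move=> Cx; apply: ge_inf; [exists 0|exists x].
have hasE n : has_inf (E n).
  split; last by exists 0.
  by have [x Cx _] := bndC n; exists (rnorm x ^+ 2), x.
have incE : {homo (fun n => inf (E n)) : m n / (m <= n)%N >-> m <= n}.
  move=> m n mn; apply: lb_le_inf; first by case: (hasE n).
  by move=> _ [x /(decC _ _ mn) Cx <-]; exact: infE.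
have ubE n : inf (E n) <= M ^+ 2.
  have [x Cx xM] := bndC n; apply: le_trans (infE _ _ Cx) _.
  by rewrite lerXn2r// nnegrE ?rnorm_ge0// (le_trans _ xM)// rnorm_ge0.
pose D := sup (range (fun n => inf (E n))).
have leD n : inf (E n) <= D.
  apply: ub_le_sup; last by exists n.
  by exists (M ^+ 2) => _ [m _ <-].
have near_min n : exists x, C n x /\ rnorm x ^+ 2 < inf (E n) + n.+1%:R^-1.
  have n0 : 0 < n.+1%:R^-1 :> R by rewrite invr_gt0.
  by have [_ [x Cx <-] xE] := inf_adherent n0 (hasE n); exists x.
have [u uP] := choice near_min.
(* The midpoint of [u m] and [u n] lies in [C k], so [|u m + u n|^2 >= 4 inf (E k)]; the
   parallelogram law turns this lower bound into an upper bound on [|u m - u n|^2]. *)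
have dist m n k : (k <= m)%N -> (k <= n)%N ->
    rnorm (u m - u n) ^+ 2 <= 4 * (D - inf (E k)) + 4 * k.+1%:R^-1.
  move=> km kn.
  have [Cm um] := uP m; have [Cn un] := uP n.
  have := infE _ _ (midC _ _ _ (decC _ _ km _ Cm) (decC _ _ kn _ Cn)).
  have -> : rnorm (2^-1 *: (u m + u n)) ^+ 2 = rnorm (u m + u n) ^+ 2 / 4.
    rewrite rnormZ ger0_norm// (_ : complex.Re 2^-1 = 2^-1).
      by rewrite exprMn mulrC; congr (_ * _); field.
    by rewrite -(rmorph_nat (real_complex R) 2) -fmorphV.
  have inv_le j : (k <= j)%N -> j.+1%:R^-1 <= k.+1%:R^-1 :> R.
    by move=> kj; rewrite lef_pV2 ?posrE// ler_nat.
  have := inv_le _ km; have := inv_le _ kn.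
  have := leD m; have := leD n; have := parallelogram (u m) (u n).
  move: um un; move: (m.+1%:R^-1) (n.+1%:R^-1) (k.+1%:R^-1) => *; lra.
have cauchy_u : cauchy (u @ \oo).
  apply: cauchy_exP => _ /gt0_real_complex[e e0 ->].
  (* Each of the two terms in [dist] carries a factor 4 and may take up half of [e ^+ 2]. *)
  have e8 : 0 < e ^+ 2 / 8 by rewrite divr_gt0// exprn_gt0.
  have supE : has_sup (range (fun n => inf (E n))).
    by split; [exists (inf (E 0)), 0%N | exists (M ^+ 2) => _ [m _ <-]].
  have [_ [k1 _ <-] k1D] := sup_adherent e8 supE.
  have [k2 _ k2P] := near_infty_natSinv_lt (PosNum e8).
  pose k := maxn k1 k2.
  exists (u k), k => // n kn.
  suff: rnorm (u k - u n) < e by rewrite -rnorm_ball.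
  rewrite -(@ltr_pXn2r _ 2)// ?nnegrE ?rnorm_ge0// ?ltW//.
  apply: le_lt_trans (dist k n k (leqnn _) kn) _.
  have /= := k2P k (leq_maxr _ _).
  have := incE _ _ (leq_maxl k1 k2 : k1 <= k)%N; rewrite -/D in k1D.
  by move: (k.+1%:R^-1) => *; lra.
have /cvg_ex[z uz] : cvg (u @ \oo) by exact: cauchy_cvg.
exists z => n B zB.
have [m _ mB] := uz _ zB.
exists (u (maxn m n)); split; last by apply: mB; exact: leq_maxl.
by apply: decC (leq_maxr m n) _ _; case: (uP (maxn m n)).
Qed.

Lemma dotC (x y : H) : dot x y = Num.conj (dot y x).
Proof. by have := hermC dot x y; rewrite mul1r. Qed.

(** Both cross terms of [|x - y|^2] equal [|y|^2], so [0 <= |x - y|^2 = |x|^2 - |y|^2]. This keeps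
    the elements of the sets [C n] below away from 0. *)
Lemma dot_eq_rnorm_le (x y : H) : dot x y = dot y y -> rnorm y <= rnorm x.
Proof.
move=> xy; have yx : dot y x = dot y y.
  by rewrite dotC xy -dotC.
have : 0 <= dot (x - y) (x - y) by exact: dnorm_ge0.
rewrite linearBl !linearBr /= xy yx subrr subr0 !dot_rnorm -rmorphB /=.
rewrite lecR subr_ge0.
by rewrite ler_pXn2r// nnegrE rnorm_ge0.
Qed.

(** * Power bounded operators and ergodic averages *)

Section PowerBounded.
Variable T : {linear H -> H}.

Lemma iterZ n (a : R[i]) (x : H) : iter n T (a *: x) = a *: iter n T x.
Proof. by elim: n => //= n ->; rewrite linearZ. Qed.

Lemma power_bounded_le : power_bounded T ->
  exists2 M : R, 0 <= M & forall n x, rnorm (iter n T x) <= M * rnorm x.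
Proof.
rewrite /power_bounded; set s := ereal_sup _ => soo.
have les n (x : H) : `|x| <= 1 -> ((rnorm (iter n T x))%:E <= s)%E.
  move=> x1; apply: (@le_trans _ _ (operator_norm (iter n T))).
    by apply: ereal_sup_ubound; exists x.
  by apply: ereal_sup_ubound; exists n.
have s0 : (0 <= s)%E.
  by apply: le_trans (les 0%N 0 _); rewrite ?lee_fin ?rnorm_ge0// normr0.
have sE : s = (fine s)%:E by rewrite fineK// ge0_fin_numE.
exists (fine s); first exact: fine_ge0.
move=> n x; have [->|x0] := eqVneq x 0.
  have -> : iter n T 0 = 0 by elim: n => //= n ->; rewrite linear0.
  by rewrite rnorm0 mulr0.
have nx0 : 0 < rnorm x by rewrite lt_def rnorm_eq0 x0 rnorm_ge0.
have nV : complex.Re `|(rnorm x)^-1%:C| = (rnorm x)^-1.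
  by rewrite ger0_norm// lecR invr_ge0 ltW.
have := les n ((rnorm x)^-1%:C *: x).
rewrite sE lee_fin iterZ rnormZ nV mulrC ler_pdivrMr//; apply.
by rewrite rnormE rnormZ nV mulVf ?gt_eqF.
Qed.

Lemma adjoint_eigenvalue (l : R[i]) (y : H) :
    power_bounded T -> 1 <= `|l| -> y != 0 ->
    (forall x, dot (T x) y = l * dot x y) ->
  exists2 z : H, z != 0 & T z = l *: z.
Proof.
move=> /power_bounded_le[M M0 TM] l1 y0 Ty.
have ny0 : 0 < rnorm y by rewrite lt_def rnorm_eq0 y0 rnorm_ge0.
have l0 : l != 0 by rewrite -normr_gt0 (lt_le_trans ltr01).
have lVX k : complex.Re `|l^-1 ^+ k| <= 1.
  have : `|l^-1 ^+ k| <= 1.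
    by rewrite normrX exprn_ile1// normfV invf_le1// (lt_le_trans ltr01).
  by rewrite lecE => /andP[].
have TX k : rnorm (l^-1 ^+ k *: iter k T y) <= M * rnorm y.
  by rewrite rnormZ (le_trans _ (TM k y))// ler_piMl ?rnorm_ge0.
pose L := complex.Re `|l|.
have L0 : 0 <= L by have := normr_ge0 l; rewrite lecE => /andP[].
(* The sum [T (A n) - l *: A n] telescopes to two terms, of norms at most [M |y|] and [|y|] up to
   the factor [L / (n + 1)]. *)
pose c := L * ((M + 1) * rnorm y).
pose C n :=
  [set x : H | rnorm (T x - l *: x) <= n.+1%:R^-1 * c /\ dot x y = dot y y].
pose A n : H := n.+1%:R^-1 *: \sum_(k < n.+1) l^-1 ^+ k *: iter k T y.
have ReV n : complex.Re `|n.+1%:R^-1 : R[i]| = n.+1%:R^-1.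
  by rewrite ger0_norm ?invr_ge0// -(rmorph_nat (real_complex R)) -fmorphV.
have Tk k : dot (iter k T y) y = l ^+ k * dot y y.
  by elim: k => [|k IH] /=; rewrite ?mul1r// Ty IH exprS mulrA.
have n0 n : n.+1%:R != 0 :> R[i] by rewrite pnatr_eq0.
have CA n : C n (A n).
  split.
    have -> : T (A n) - l *: A n =
        n.+1%:R^-1 *: (l *: (l^-1 ^+ n.+1 *: iter n.+1 T y - y)).
      rewrite linearZ scalerA (mulrC l) -scalerA -scalerBr.
      rewrite linear_sum scaler_sumr -sumrB.
      congr (_ *: _); pose f k := l *: (l^-1 ^+ k *: iter k T y).
      (* [T] sends the summand [l^-k T^k y] to [f k.+1], while [l] sends it to [f k]. *)
      transitivity (\sum_(0 <= k < n.+1) (f k.+1 - f k)).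
        rewrite big_mkord; apply: eq_bigr => k _; congr (_ - _).
        by rewrite /f linearZ/= scalerA exprS mulrA divff// mul1r.
      by rewrite telescope_sumr// /f /= scale1r scalerBr.
    rewrite rnormZ ReV ler_wpM2l ?invr_ge0// rnormZ ler_wpM2l//.
    by rewrite (le_trans (rnormB _ _))// mulrDl mul1r lerD2r.
  rewrite linearZl_LR linear_sumlz (eq_bigr (fun=> dot y y)) /=; last first.
    by move=> k _; rewrite linearZl_LR /= Tk mulrA -exprMn mulVf// expr1n mul1r.
  by rewrite sumr_const card_ord -[dot y y *+ _]mulr_natl mulrA mulVf// mul1r.
have NA n : rnorm (A n) <= M * rnorm y.
  rewrite rnormZ ReV mulrC ler_pdivrMr// mulr_natr.
  rewrite -[X in _ *+ X]card_ord -sumr_const.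
  elim/big_ind2 : _ => [|a b x z xa zb|k _]; last exact: TX.
    by rewrite le_eqVlt rnorm_eq0 eqxx.
  by rewrite (le_trans (rnormD _ _))// lerD.
have [z zC] : exists z, forall n, closure (C n) z.
  apply: (@nested_midconvex_closure C (M * rnorm y)).
  - move=> m n mn x [xn xy]; split=> //; apply: le_trans xn _.
    rewrite ler_wpM2r ?mulr_ge0 ?addr_ge0 ?ler01 ?rnorm_ge0//.
    by rewrite lef_pV2 ?posrE// ler_nat.
  - move=> n x x' [xn xy] [xn' xy']; split; last first.
      by rewrite linearZl_LR linearDl /= xy xy'; field.
    have -> : T (2^-1 *: (x + x')) - l *: (2^-1 *: (x + x')) =
        2^-1 *: ((T x - l *: x) + (T x' - l *: x')).
      rewrite linearZ linearD [l *: _]scalerA (mulrC l) -scalerA -scalerBr.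
      by rewrite (scalerDr l) opprD addrACA.
    rewrite rnormZ (ReV 1%N) mulrC ler_pdivrMr//.
    by apply: le_trans (rnormD _ _) _; rewrite mulr_natr mulr2n; exact: lerD.
  - by move=> n; exists (A n).
exists z.
  (* As [z] is only a closure point, compare it with some [x] in [C 0] at distance less than
     [|y| / 2]: since [|x| >= |y|], this leaves [|z| >= |y| / 2]. *)
  rewrite -rnorm_eq0 gt_eqF//; apply: lt_le_trans (_ : 0 < rnorm y / 2) _.
    by rewrite divr_gt0.
  have [x [_ /dot_eq_rnorm_le xy] zx] :=
    closure_rnorm _ _ (zC 0%N) _ (divr_gt0 ny0 (ltr0Sn R 1)).
  have := rnormD z (x - z).
  by rewrite addrC subrK -(rnormN (x - z)) opprB; lra.
apply/eqP; rewrite -subr_eq0 -rnorm_eq0 eq_le rnorm_ge0 andbT.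
apply/ler_addgt0Pr => e e0; rewrite add0r.
have c0 : 0 <= c by rewrite !mulr_ge0 ?addr_ge0 ?ler01 ?rnorm_ge0.
(* With [x] in [C n] within [d] of [z], replacing [z] by [x] costs at most [(M + L) d <= e / 2].
   Likewise [n] is taken so large that [c / (n + 1) <= e / 2]. The added 1 keeps each denominator
   positive. *)
pose d := e / (2 * (M + L + 1)).
have ML : 0 < 2 * (M + L + 1) by lra.
have d0 : 0 < d by rewrite divr_gt0.
have e2c : 0 < e / (2 * (c + 1)) by rewrite divr_gt0//; lra.
have [n _ /(_ n (leqnn n)) /= nP] := near_infty_natSinv_lt (PosNum e2c).
have [x [xn _] zx] := closure_rnorm _ _ (zC n) _ d0.
have -> : T z - l *: z = (T (z - x) - l *: (z - x)) + (T x - l *: x).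
  by rewrite addrACA -linearD subrK -opprD -scalerDr subrK.
have Tzx : rnorm (T (z - x)) <= M * d.
  by rewrite (le_trans (TM 1%N _))// ler_wpM2l// ltW.
have lzx : rnorm (l *: (z - x)) <= L * d.
  by rewrite rnormZ ler_wpM2l// ltW.
have := rnormD (T (z - x) - l *: (z - x)) (T x - l *: x).
have := rnormB (T (z - x)) (l *: (z - x)).
have : rnorm (T x - l *: x) <= e / 2.
  apply: le_trans xn _.
  apply: le_trans (_ : e / (2 * (c + 1)) * (c + 1) <= _).
    by apply: ler_pM; rewrite ?invr_ge0// ?ltW// ltrDl.
  by rewrite invfM mulrA divfK ?gt_eqF//; lra.
have : (M + L + 1) * d = e / 2 by rewrite /d; field; lra.
by clearbody d; lra.
Qed.

End PowerBounded.

End HilbertSpace.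

(** * Residual spectrum *)

Theorem theorem4p1 (R : realType) (H : completeNormedModType R[i])
    (dot : {dot H for Num.conj}) (hdot : inner_product_of_norm dot)
    (hdim : ~ finite_dimensional H)
    (T : {linear H -> H}) (hT : bounded_near T (nbhs (0 : H))) (hpb : power_bounded T) :
  residual_spectrum dot T `<=` open_unit_disk R.
Proof.
move=> _ [[m mP <-] notP]; rewrite /open_unit_disk /=.
have [//|l1] := real_ltP (normr_real (Num.conj m)) (real1 _).
have [y adjy y0] : exists2 y, adjoint dot T y = m *: y & y != 0.
  apply: contrapT => noy; apply: mP; apply/seteqP; split=> [x /= /eqP|_ ->] /=.
    rewrite subr_eq0 => /eqP mx; apply: contrapT => /eqP x0.
    by apply: noy; exists x.
  (* It remains to see that [adjoint dot T 0 = 0]: a vector [z] representing [x |-> dot (T x) 0] has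
     [dot z z = dot (T z) 0 = 0], and the default value is also 0. *)
  rewrite scaler0 sub0r; apply/eqP; rewrite oppr_eq0 /adjoint; apply/eqP.
  case: xgetP => // z _ zP.
  by apply/eqP; rewrite -(dnorm_eq0 dot) -zP linear0r.
(* If no vector represents [x |-> dot (T x) y], the default value of [adjoint]
   forces [m = 0], so the Riesz representation theorem is not needed. *)
have Ty x : dot (T x) y = Num.conj m * dot x y.
  move: adjy; rewrite /adjoint; case: xgetP => [z _ zP zE|_ /esym/eqP].
    by rewrite zP zE linearZr_LR.
  rewrite scaler_eq0 (negPf y0) orbF => /eqP m0.
  by move: l1; rewrite m0 rmorph0 normr0 ler10.
have [z z0 Tz] := adjoint_eigenvalue hdot _ _ _ hpb l1 y0 Ty.
(* The eigenvector [z] would lie in a trivial kernel. *)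
case: notP; rewrite /point_spectrum /= => ker0.
move: z0; suff -> : z = 0 by rewrite eqxx.
by rewrite -[z = 0]/([set 0] z) -ker0 /= Tz subrr.
Qed.
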